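(* Let $n\ge 3$. The number of isomorphism classes of semirigid commutative $3$-nilpotent semigroups of cardinality $n$ is at most $$\sum_{r=1}^{n-2}\ \sum_{\lambda\vdash r}\frac{\left\{ {\gamma(\lambda)+1 \atop n-r} \right\}}{w(\lambda)}.$$
   Context: A semigroup $S$ is $3$-nilpotent if it is finite, has a zero $0$, satisfies $xyz=0$ for all $x,y,z$, and $ab\ne0$ for some $a,b$. $S$ is semirigid if every automorphism of $S$ fixes every element of $S^2$. $\left\{ {a \atop b} \right\}$ is the Stirling number of the second kind ($0$ if $b>a$). For $\lambda\vdash r$ with parts listed with repetition as $\lambda_1,\dots,\lambda_s$: $\beta(\lambda)=\sum_{i,j=1}^{s}\gcd(\lambda_i,\lambda_j)$ (ordered pairs); $\delta(\lambda)=\sum_{i=1}^{s}(1+e(\lambda_i))$ where $e(m)=1$ if $m$ is even and $0$ otherwise; $\gamma(\lambda)=\tfrac12(\beta(\lambda)+\delta(\lambda))$. If the distinct part sizes are $\ell_1,\dots,\ell_q$ with multiplicities $\mu_1,\dots,\mu_q$, $w(\lambda)=\ell_1^{\mu_1}\cdots\ell_q^{\mu_q}\mu_1!\cdots\mu_q!$. *)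

(* Defs.v *)
From mathcomp Require Import all_boot all_order all_fingroup all_algebra.
From mathcomp Require Import zify.

Set Implicit Arguments.
Unset Strict Implicit.
Unset Printing Implicit Defensive.

Section Semigroups.

Variable T : finType.

(* Multiplication tables on T. They form a finType, so that semigroups with
   carrier T can be counted. *)
Definition table := {ffun T * T -> T}.

Implicit Type m : table.

Definition is_semigroup m : bool :=
  [forall x, forall y, forall z, m (x, m (y, z)) == m (m (x, y), z)].

Definition is_commutative m : bool :=
  [forall x, forall y, m (x, y) == m (y, x)].

Definition is_zero m (o : T) : bool :=
  [forall x, (m (o, x) == o) && (m (x, o) == o)].

(* Finiteness is built into T. *)
Definition is_3nilpotent m : bool :=
  [exists o, [&& is_zero m o,
    [forall x, forall y, forall z, m (m (x, y), z) == o] &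
    [exists a, exists b, m (a, b) != o]]].

Definition square m : {set T} := [set m p | p in [set: T * T]].

Definition is_isomorphism m1 m2 (f : {perm T}) : bool :=
  [forall x, forall y, f (m1 (x, y)) == m2 (f x, f y)].

Definition isomorphic : rel table :=
  fun m1 m2 => [exists f : {perm T}, is_isomorphism m1 m2 f].

Definition is_automorphism m (f : {perm T}) : bool := is_isomorphism m m f.

Definition is_semirigid m : bool :=
  [forall f : {perm T}, is_automorphism m f ==>
    [forall x in square m, f x == x]].

Definition semirigid_comm_3nilpotent : {set table} :=
  [set m | [&& is_semigroup m, is_commutative m, is_3nilpotent m
             & is_semirigid m]].

Lemma isomorphic_equivalence : equivalence_rel isomorphic.
Proof.
have isoxx m : isomorphic m m.
  apply/existsP; exists 1%g; apply/forallP => x; apply/forallP => y.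
  by rewrite !perm1.
have iso_sym m1 m2 : isomorphic m1 m2 -> isomorphic m2 m1.
  case/existsP=> f /forallP isof; apply/existsP; exists f^-1%g.
  apply/forallP => x; apply/forallP => y; apply/eqP/(@perm_inj _ f).
  by rewrite permKV (eqP (forallP (isof _) _)) !permKV.
have iso_trans m1 m2 m3 :
    isomorphic m1 m2 -> isomorphic m2 m3 -> isomorphic m1 m3.
  case/existsP=> f /forallP isof /existsP[g /forallP isog].
  apply/existsP; exists (f * g)%g; apply/forallP => x; apply/forallP => y.
  by rewrite !permM (eqP (forallP (isof _) _)) (eqP (forallP (isog _) _)).
move=> m1 m2 m3; split=> // iso12.
by apply/idP/idP; apply: iso_trans => //; apply: iso_sym.
Qed.

End Semigroups.

(* Every semigroup of cardinality n is isomorphic to one with carrier 'I_n. *)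
Definition num_semirigid_comm_3nilpotent (n : nat) : nat :=
  #|equivalence_partition (@isomorphic 'I_n)
      (semirigid_comm_3nilpotent 'I_n)|.

Definition stirling2 (a b : nat) : nat :=
  #|[set P : {set {set 'I_a}} | partition P [set: 'I_a] && (#|P| == b)]|.

Definition is_intpart (r : nat) (s : seq nat) : bool :=
  [&& sorted geq s, all (ltn 0) s & sumn s == r].

(* A partition of r has at most r parts, each of them at most r. *)
Definition intparts (r : nat) : seq (seq nat) :=
  [seq s <- [seq map val (t : seq 'I_r.+1) | t : r.-bseq 'I_r.+1]
     | is_intpart r s].

Lemma mem_intparts r s : (s \in intparts r) = is_intpart r s.
Proof.
rewrite mem_filter andb_idr // => /and3P[_ s_gt0 /eqP sum_s].
have szs : size s <= r.
  rewrite -{r}sum_s; elim: s s_gt0 => //= x s IHs /andP[x_gt0 /IHs]; lia.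
have les x : x \in s -> x < r.+1.
  rewrite -{r szs}sum_s; elim: s {s_gt0} => //= y s IHs.
  rewrite inE => /predU1P[->|/IHs]; lia.
have szt : size [seq inord x : 'I_r.+1 | x <- s] <= r by rewrite size_map.
apply/mapP; exists (Bseq szt); first by rewrite mem_enum.
rewrite /= -map_comp -[LHS]map_id; apply/eq_in_map => x /les ltxr /=.
by rewrite inordK.
Qed.

Lemma intparts_uniq r : uniq (intparts r).
Proof.
apply/filter_uniq; rewrite map_inj_uniq ?enum_uniq //.
by move=> t u /(inj_map val_inj) /val_inj.
Qed.

Definition beta (s : seq nat) : nat :=
  \sum_(x <- s) \sum_(y <- s) gcdn x y.

Definition delta (s : seq nat) : nat :=
  \sum_(x <- s) (1 + ~~ odd x).

(* The sum is always even (see odd_beta_delta), so the halving is exact. *)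
Definition gamma (s : seq nat) : nat := (beta s + delta s)./2.

Lemma odd_beta_delta s : odd (beta s + delta s) = false.
Proof.
rewrite /beta /delta; elim: s => [|x s IHs]; first by rewrite !big_nil.
rewrite !big_cons gcdnn.
under [X in _ + X + _]eq_bigr => y _ do rewrite big_cons gcdnC.
rewrite big_split /=; move: IHs.
set A := \sum_(_ <- s) gcdn _ _; set B := \sum_(_ <- s) \sum_(_ <- s) _.
set D := \sum_(_ <- s) (1 + _).
rewrite !oddD oddb.
by case: (odd x); case: (odd A); case: (odd B); case: (odd D).
Qed.

Definition w (s : seq nat) : nat :=
  \prod_(l <- undup s) (l ^ count_mem l s * (count_mem l s)`!).

(* Main.v *)
Require Import Defs.
From mathcomp Require Import all_boot all_order all_fingroup all_algebra.
From mathcomp Require Import zify.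

(* By Burnside's lemma, n! times the number of isomorphism classes counts the
   pairs (m, s) of a semirigid table m and an automorphism s of m. Semirigidity
   makes s fix the square of m pointwise, so s lives on the complement A of the
   square, and m amounts to a zero and a map that is constant on the orbits of s
   on unordered pairs of A, together covering the complement of A. If s has cycle
   type l on A and r = #|A|, there are gamma(l) such orbits, hence at most
   (n - r)! stirling2 (gamma(l) + 1) (n - r) tables; there are r!/w(l)
   permutations of A of type l and n!/(r! (n - r)!) sets A of size r. *)

Set Implicit Arguments.
Unset Strict Implicit.
Unset Printing Implicit Defensive.

Import Order.TTheory GRing.Theory Num.Theory.

(* Not the order of a group element, which [all_fingroup] also calls [order]. *)
Local Notation order := fingraph.order.

(** * Maps onto a given set, counted through their kernels *)

Lemma card_le_fiber_bound (X Y : finType) (S : {set X}) (D : {set Y})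
    (h : X -> Y) (b : nat) :
  {in S, forall x, h x \in D} ->
  {in D, forall y, #|[set x in S | h x == y]| <= b} ->
  #|S| <= #|D| * b.
Proof.
move=> hS hb; rewrite -sum1_card (partition_big h (mem D)) //=.
rewrite -sum_nat_const; apply: leq_sum => y Dy.
by apply: leq_trans (hb y Dy); rewrite sum1dep_card.
Qed.

(** The kernel of a map onto [B] partitions the indices into [#|B|] blocks. A map with a given
    kernel is determined by its values on a transversal of the blocks, and there it is injective. *)
Lemma card_ffun_im_eq (k : nat) (T : finType) (B : {set T}) :
  #|[set g : {ffun 'I_k -> T} | g @: [set: 'I_k] == B]|
    <= stirling2 k #|B| * #|B|`!.
Proof.
pose ker (g : {ffun 'I_k -> T}) := preim_partition g [set: 'I_k].
have mem_ker g i j : (j \in pblock (ker g) i) = (g i == g j).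
  apply: (@pblock_equivalence_partition _ (fun x y => g x == g y));
    rewrite ?inE // => x y z _ _ _; split=> [|/eqP->] //; exact: eqxx.
have kerE g : ker g = [set [set j | g i == g j] | i in [set: 'I_k]].
  rewrite /ker /preim_partition /equivalence_partition.
  by apply: eq_imset => i; apply/setP => j; rewrite !inE.
have card_ker g : #|ker g| = #|g @: [set: 'I_k]|.
  have -> : ker g = (fun y => [set j | y == g j]) @: (g @: [set: 'I_k]).
    by rewrite kerE -imset_comp; apply: eq_imset.
  rewrite card_in_imset // => _ _ /imsetP[i _ ->] /imsetP[j _ ->] /setP/(_ j).
  by rewrite !inE eqxx => /eqP.
apply: (@card_le_fiber_bound _ _ _ _ ker) => [g|P].
  by rewrite !inE card_ker => /eqP->; rewrite preim_partitionP eqxx.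
rewrite inE => /andP[partP /eqP cardP].
have transv := transversalP partP; set X := transversal P _ in transv.
pose rho (g : {ffun 'I_k -> T}) : {ffun {x | x \in X} -> T} :=
  [ffun x => g (val x)].
have cX : #|{: {x | x \in X}}| = #|B|.
  by rewrite card_sig -cardP -(card_transversal transv).
have kg_eq g i j : ker g = P -> (g i == g j) = (j \in pblock P i).
  by move=> <-; rewrite mem_ker.
(* Written as a falling factorial, the bound counts the injections of the transversal [X] into
   [B]. *)
have -> : #|B|`! = #|B| ^_ #|{: {x | x \in X}}| by rewrite cX ffactnn.
rewrite -(card_inj_ffuns_on _ (mem B)) -(@card_in_imset _ _ rho).
  apply/subset_leq_card/subsetP => _ /imsetP[g gM ->].
  move: gM => /[1!inE]/andP[/[1!inE]/eqP gB /eqP kg].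
  rewrite inE; apply/andP; split.
    by apply/ffun_onP => x; rewrite ffunE -gB imset_f.
  apply/injectiveP => x y; rewrite !ffunE => /eqP.
  rewrite (kg_eq _ _ _ kg) => yx.
  apply: val_inj; apply: (pblock_inj transv) (valP x) (valP y) _ => /=.
  apply/eqP; rewrite eq_pblock ?(partition_trivIset partP) //.
  by rewrite (cover_partition partP) inE.
move=> g1 g2 /[1!inE]/andP[_ /eqP k1] /[1!inE]/andP[_ /eqP k2] /ffunP e12.
apply/ffunP => i.
have Xi : transversal_repr i X (pblock P i) \in X.
  apply: (repr_mem_transversal transv).
  by rewrite pblock_mem // (cover_partition partP) inE.
have := repr_mem_pblock transv i (pblock_mem (P := P) (x := i) _).
rewrite (cover_partition partP) inE => /(_ isT).
set j := transversal_repr _ _ _ in Xi * => ji.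
have := e12 (exist _ j Xi); rewrite !ffunE /= => ej.
have /eqP-> : g1 i == g1 j by rewrite (kg_eq _ _ _ k1).
by apply/esym/eqP; rewrite ej eq_sym eq_sym (kg_eq _ _ _ k2).
Qed.

(** * Simultaneous shifts modulo one or two cycle lengths *)

(** The Chinese remainder theorem for moduli that need not be coprime: [k] must be [a2 - a1] modulo
    [l1] and [b2 - b1] modulo [l2], and these differences agree modulo the gcd. *)
Lemma exists_common_shift l1 l2 a1 b1 a2 b2 :
    0 < l1 -> 0 < l2 -> a1 <= l1 -> b1 <= l2 -> b2 <= l2 ->
    a1 + (l2 - b1) = a2 + (l2 - b2) %[mod gcdn l1 l2] ->
  exists2 k, a1 + k = a2 %[mod l1] & b1 + k = b2 %[mod l2].
Proof.
move=> l1_gt0 l2_gt0 a1l b1l b2l eqm.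
(* The two required residues, each raised by its modulus to stay a natural number. *)
set p := a2 + (l1 - a1); set q := b2 + (l2 - b1).
have pqE : q + (a2 + (l2 - b2) + l1) = p + (a1 + (l2 - b1) + l2).
  by rewrite /p /q; clear -a1l b1l b2l; lia.
set g := gcdn l1 l2 in eqm.
(* The multiple [p * l2] changes nothing modulo [l2] and keeps the later subtraction of [p] from
   being truncated. *)
have eq_pq : q + p * l2 = p %[mod g].
  have multl c : g %| c * l1 by rewrite dvdn_mull ?dvdn_gcdl.
  have multr c : g %| c * l2 by rewrite dvdn_mull ?dvdn_gcdr.
  have eqX : (a2 + (l2 - b2)) + l1 = a1 + (l2 - b1) + l2 %[mod g].
    have [/eqP e1 /eqP e2] := (multl 1, multr 1); rewrite !mul1n in e1 e2.
    by rewrite -modnDmr e1 -[RHS]modnDmr e2 !addn0.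
  apply/eqP; rewrite -[_ %% g]modnDmr (eqP (multr p)) addn0.
  rewrite -(eqn_modDr (a2 + (l2 - b2) + l1)) -[X in _ == X]modnDmr eqX modnDmr.
  by rewrite pqE.
have le_pq : p <= q + p * l2.
  by rewrite (leq_trans (leq_pmulr p l2_gt0)) ?leq_addl.
have /dvdnP[t tE] : g %| q + p * l2 - p by rewrite -eqn_mod_dvd // eq_pq.
have [km kn bez _] := egcdnP l2 l1_gt0; rewrite -/g in bez.
(* By Bezout, [km * l1] is the gcd modulo [l2], so the added term is [q - p] modulo [l2] and
   vanishes modulo [l1]. *)
exists (p + t * km * l1).
  by rewrite addnA addnC modnMDl /p addnCA subnKC // modnDr.
have -> : b1 + (p + t * km * l1) = (p + 1 + t * kn) * l2 + b2.
  have -> : t * km * l1 = t * kn * l2 + (q + p * l2 - p).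
    by rewrite -mulnA bez tE mulnDr mulnA.
  rewrite 2!(mulnDl _ _ l2) mul1n; move: le_pq; rewrite /q.
  by move: (t * kn * l2) (p * l2) => u v; clear -b1l; lia.
by rewrite modnMDl.
Qed.

(** On a cycle of length [l], the cyclic distance determines an unordered pair up to rotation; the
    second alternative rotates the pair onto its swap. *)
Lemma exists_cyclic_shift l a1 b1 a2 b2 :
    a1 < l -> b1 < l -> a2 < l -> b2 < l ->
    minn ((a1 - b1) + (b1 - a1)) (l - ((a1 - b1) + (b1 - a1))) =
    minn ((a2 - b2) + (b2 - a2)) (l - ((a2 - b2) + (b2 - a2))) ->
  exists k, (a1 + k = a2 %[mod l] /\ b1 + k = b2 %[mod l])
         \/ (b1 + k = a2 %[mod l] /\ a1 + k = b2 %[mod l]).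
Proof.
move=> la1 lb1 la2 lb2 eqd.
have modl x y c : x = y + c * l -> x = y %[mod l].
  by move->; rewrite addnC modnMDl.
(* Equal distances mean [a1 - b1] is [a2 - b2] or its opposite modulo [l]. All residues are below
   [l], so the two sides differ by [0] or by [l] either way. *)
have [e|e] :
     (a1 + b2 = a2 + b1 \/ a1 + b2 = a2 + b1 + l \/ a1 + b2 + l = a2 + b1) \/
     (b1 + b2 = a2 + a1 \/ b1 + b2 = a2 + a1 + l \/ b1 + b2 + l = a2 + a1) by lia.
- exists (a2 + (l - a1)); left; split; first by apply: (modl _ _ 1); lia.
  case: e => [e|[e|e]];
    [apply: (modl _ _ 1)|apply: (modl _ _ 0)|apply: (modl _ _ 2)]; lia.
- exists (a2 + (l - b1)); right; split; first by apply: (modl _ _ 1); lia.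
  case: e => [e|[e|e]];
    [apply: (modl _ _ 1)|apply: (modl _ _ 0)|apply: (modl _ _ 2)]; lia.
Qed.

(** * The weight [w] and the invariance of [gamma] *)

(** One more part [l] alters only the factor of [l] in the product. The ratio is the number of
    points on [l]-cycles in a permutation of type [l :: s]. *)
Lemma w_cons l s : w (l :: s) = (count_mem l s).+1 * l * w s.
Proof.
pose F k m := k ^ m * m`!.
have others (r : seq nat) : \prod_(k <- r | k != l) F k (count_mem k (l :: s))
    = \prod_(k <- r | k != l) F k (count_mem k s).
  by apply: eq_bigr => k kl; rewrite /= eq_sym (negbTE kl).
have FS : F l (count_mem l s).+1 = (count_mem l s).+1 * l * F l (count_mem l s).
  by rewrite /F expnS factS mulnACA mulnC [_ * l]mulnC -!mulnA; lia.
rewrite /w /=; case: ifP => ls.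
  rewrite (bigD1_seq l) ?mem_undup ?undup_uniq //=.
  rewrite [in RHS](bigD1_seq l) ?mem_undup ?undup_uniq //=.
  have := others (undup s); rewrite /F /= => ->.
  by rewrite eqxx add1n mulnA -/(F _ _) FS.
have l0 : count_mem l s = 0 by apply/count_memPn; rewrite ls.
rewrite big_cons /= eqxx l0 mul1n; congr (_ * _); first by rewrite expn1 muln1.
rewrite !big_seq; apply: eq_bigr => k; rewrite mem_undup => ks.
by rewrite (_ : (l == k) = false) //; apply: contraFF ls => /eqP->.
Qed.

Lemma w_gt0 s : all (ltn 0) s -> 0 < w s.
Proof.
elim: s => [|l s IH]; rewrite ?w_cons ?/w ?big_nil //= => /andP[l0 /IH].
by rewrite !muln_gt0 l0.
Qed.

Lemma perm_gamma s t : perm_eq s t -> gamma s = gamma t.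
Proof.
move=> st; rewrite /gamma /beta /delta !(perm_big _ st) /=.
by congr (_ + _)./2; apply: eq_bigr => x _; rewrite (perm_big _ st).
Qed.

(** * Orbits of a permutation on unordered pairs *)

Section CycleType.

Variable T : finType.
Implicit Types (f : {perm T}) (A : {set T}).

Definition cycle_roots f A : {set T} := [set r in A | froots f r].

(** Fixed points in [A] count as parts equal to 1. The parts come unsorted, so types are compared by
    [perm_eq]. *)
Definition cycle_type f A : seq nat :=
  [seq order f r | r <- enum (cycle_roots f A)].

Lemma iter_eq_mod f (r : T) i j :
  i = j %[mod order f r] -> iter i f r = iter j f r.
Proof.
move=> eqij; rewrite (divn_eq i (order f r)) (divn_eq j (order f r)) eqij.
have iterm c : iter (c * order f r) f r = r.
  by elim: c => // c IH; rewrite mulSn iterD IH (iter_order (@perm_inj _ f)).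
by rewrite addnC iterD iterm addnC iterD iterm.
Qed.

Lemma perm_connect_sym f : connect_sym (frel f).
Proof. exact/fconnect_sym/perm_inj. Qed.

Lemma perm_on_fconnect f A x y :
  perm_on A f -> fconnect f x y -> (x \in A) = (y \in A).
Proof.
move=> Af; apply: closed_connect => {}x {}y /eqP<-.
by rewrite (perm_closed _ Af).
Qed.

Lemma froot_cycle_roots f A x :
  perm_on A f -> x \in A -> froot f x \in cycle_roots f A.
Proof.
move=> Af Ax; rewrite inE -(perm_on_fconnect Af (connect_root _ x)) Ax.
by rewrite roots_root //; apply: perm_connect_sym.
Qed.

Definition same_pair_orbit f (x y x' y' : T) : Prop :=
  exists k, (iter k f x = x' /\ iter k f y = y')
         \/ (iter k f y = x' /\ iter k f x = y').

(** The number of orbits on unordered pairs, equal points allowed, with one point in the cycle of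
    [r] and one in that of [s]: the cyclic distances within one cycle, the offsets modulo the gcd
    between two. The value 0 in one order of [r] and [s] avoids counting two cycles twice. *)
Definition pair_classes f (r s : T) : nat :=
  if r == s then (order f r)./2.+1 else
  if enum_rank r < enum_rank s then gcdn (order f r) (order f s) else 0.

(** Add the double sum to its transpose. Off the diagonal this leaves one gcd per ordered pair of
    cycles; on it, twice [l./2.+1] is [l + 1], plus 1 if [l] is even. *)
Lemma gamma_cycle_type f A :
  gamma (cycle_type f A) =
  \sum_(r in cycle_roots f A) \sum_(s in cycle_roots f A) pair_classes f r s.
Proof.
set R := cycle_roots f A.
rewrite /gamma; suff -> : beta (cycle_type f A) + delta (cycle_type f A) =
    (\sum_(r in R) \sum_(s in R) pair_classes f r s).*2 by rewrite doubleK.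
rewrite /beta /delta !big_map !big_enum /= -addnn.
rewrite [X in _ = _ + X]exchange_big /= -!big_split /=.
apply: eq_bigr => r Rr.
rewrite big_map big_enum /= -big_split /= (bigD1 r) //= [RHS](bigD1 r) //=.
rewrite addnAC /pair_classes eqxx gcdnn; congr (_ + _).
  rewrite -[in LHS](odd_double_half (order f r)) oddD odd_double addbF oddb.
  by case: odd => /=; lia.
apply: eq_bigr => s /andP[Rs sr]; rewrite eq_sym (negbTE sr).
by case: ltngtP => [_|_|/val_inj/enum_rank_inj];
  rewrite ?addn0 1?gcdnC // => /eqP; rewrite eq_sym (negbTE sr).
Qed.

(* The offset of [x] against [y] along their cycles is invariant modulo the gcd
   of the two lengths; on a single cycle it is only defined up to sign. *)
Definition pair_offset f (x y : T) : nat :=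
  let r := froot f x in let s := froot f y in
  let a := findex f r x in let b := findex f s y in
  if r == s then minn ((a - b) + (b - a)) (order f r - ((a - b) + (b - a)))
  else (a + (order f s - b)) %% gcdn (order f r) (order f s).

(** Positions along the cycles turn iteration of [f] into addition modulo the cycle lengths, so the
    two shift lemmas supply the exponent. *)
Lemma pair_offset_sep f (x y x' y' : T) :
    froot f x = froot f x' -> froot f y = froot f y' ->
    pair_offset f x y = pair_offset f x' y' ->
  same_pair_orbit f x y x' y'.
Proof.
have rc z : fconnect f (froot f z) z by rewrite perm_connect_sym connect_root.
move=> rx ry; have := (rc x, rc x', (rc y, rc y')).
rewrite /pair_offset -rx -ry; move: (froot f x) (froot f y) => r s.
case=> [[cx cx'] [cy cy']].
have iterk k u a : fconnect f u a -> iter k f a = iter (findex f u a + k) f u.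
  by move=> cua; rewrite addnC iterD iter_findex.
case: eqP => [rs|_].
  rewrite -{s ry}rs in cy cy' *.
  case/exists_cyclic_shift; rewrite ?findex_max // => k [] [e1 e2]; exists k.
    left; rewrite (iterk _ _ _ cx) (iterk _ _ _ cy).
    by rewrite (iter_eq_mod e1) (iter_eq_mod e2) !iter_findex.
  right; rewrite (iterk _ _ _ cx) (iterk _ _ _ cy).
  by rewrite (iter_eq_mod e1) (iter_eq_mod e2) !iter_findex.
case/exists_common_shift;
  rewrite ?fingraph.order_gt0 // 1?ltnW ?findex_max // => k e1 e2.
exists k; left; rewrite (iterk _ _ _ cx) (iterk _ _ _ cy).
by rewrite (iter_eq_mod e1) (iter_eq_mod e2) !iter_findex.
Qed.

(** A cyclic distance is at most half the length, and a residue is below its modulus. The hypothesis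
    on ranks excludes the order in which [pair_classes] is 0. *)
Lemma pair_offset_lt f (x y : T) :
    enum_rank (froot f x) <= enum_rank (froot f y) ->
  pair_offset f x y < pair_classes f (froot f x) (froot f y).
Proof.
have rc z : fconnect f (froot f z) z by rewrite perm_connect_sym connect_root.
rewrite /pair_offset /pair_classes; case: eqP => [rs _|rs].
  have := findex_max (rc x); have := findex_max (rc y); rewrite -rs.
  by move: (findex _ _ _) (findex _ _ _) (order _ _) => a b l; lia.
rewrite leq_eqVlt => /orP[/eqP/val_inj/enum_rank_inj//|->].
by rewrite ltn_mod gcdn_gt0 fingraph.order_gt0.
Qed.

(** A pair is coded by the roots of its cycles, listed by rank, and its offset. The possible codes
    form a set of exactly gamma elements, and [c] is the index in its enumeration. *)
Lemma exists_pair_code f A : perm_on A f ->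
  exists c : T -> T -> nat,
    {in A &, forall x y, c x y < gamma (cycle_type f A)} /\
    (forall x y x' y', x \in A -> y \in A -> x' \in A -> y' \in A ->
      c x y = c x' y' -> same_pair_orbit f x y x' y').
Proof.
move=> Af; set R := cycle_roots f A.
(* The ordinal type is wide enough to hold every offset, so [inord] loses nothing. *)
pose K := [set p : T * T * 'I_#|T|.+2 |
  [&& p.1.1 \in R, p.1.2 \in R & p.2 < pair_classes f p.1.1 p.1.2]].
have ordT r : order f r <= #|T| by apply: max_card.
have classesT r s : pair_classes f r s <= #|T|.+2.
  rewrite /pair_classes; case: eqP => _; first by have := ordT r; lia.
  case: ltnP => // _.
  apply: leq_trans (dvdn_leq (fingraph.order_gt0 _ _) (dvdn_gcdl _ _)) _.
  by apply: leq_trans (ordT r) _; lia.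
have cardK : #|K| = gamma (cycle_type f A).
  rewrite gamma_cycle_type -/R -sum1_card.
  rewrite (eq_bigl (fun p : T * T * 'I_#|T|.+2 =>
     ((p.1.1 \in R) && (p.1.2 \in R)) &&
     (p.2 < pair_classes f p.1.1 p.1.2))); last by move=> p; rewrite inE andbA.
  rewrite -(pair_big_dep (fun p : T * T => (p.1 \in R) && (p.2 \in R))
     (fun p (i : 'I_#|T|.+2) => i < pair_classes f p.1 p.2) (fun _ _ => 1)) /=.
  rewrite -(pair_big (mem R) (mem R)
    (fun r s => \sum_(i < #|T|.+2 | i < pair_classes f r s) 1)) /=.
  apply: eq_bigr => r _; apply: eq_bigr => s _.
  rewrite -(big_ord_widen _ (fun _ => 1)) //.
  by rewrite sum1_card card_ord.
pose code0 x y : T * T * 'I_#|T|.+2 :=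
  (froot f x, froot f y, inord (pair_offset f x y)).
pose le x y := enum_rank (froot f x) <= enum_rank (froot f y).
pose code x y := if le x y then code0 x y else code0 y x.
have code0K x y : x \in A -> y \in A -> le x y -> code0 x y \in K.
  move=> Ax Ay lexy; rewrite inE /= !froot_cycle_roots //= inordK.
    exact: pair_offset_lt.
  by apply: leq_trans (pair_offset_lt lexy) _.
have codeK x y : x \in A -> y \in A -> code x y \in K.
  move=> Ax Ay; rewrite /code; case: ifP => lexy; apply: code0K => //.
  by rewrite /le leqNgt; apply: contraFN lexy => /ltnW.
have code0_sep x y x' y' : le x y -> le x' y' -> code0 x y = code0 x' y' ->
    same_pair_orbit f x y x' y'.
  move=> lexy lexy' [rx ry] e; apply: pair_offset_sep => //.
  have bnd u v : le u v -> pair_offset f u v < #|T|.+2.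
    by move=> leuv; apply: leq_trans (pair_offset_lt leuv) _.
  by have /(congr1 val) := e; rewrite /= !inordK // bnd.
exists (fun x y => index (code x y) (enum K)).
split=> [x y Ax Ay|x y x' y' Ax Ay Ax' Ay' e].
  by rewrite -cardK cardE index_mem mem_enum codeK.
have {e} : code x y = code x' y'.
  have nthK u v : u \in A -> v \in A ->
      nth (code x y) (enum K) (index (code u v) (enum K)) = code u v.
    by move=> Au Av; rewrite nth_index // mem_enum codeK.
  by rewrite -(nthK x' y') // -e nthK.
have leN u v : le u v = false -> le v u.
  by move=> N; rewrite /le leqNgt; apply: contraFN N => /ltnW.
(* Each pair may have been swapped to put its roots in order; [same_pair_orbit] ignores such
   swaps. *)
rewrite /code; case: ifP => l1; case: ifP => l2 /code0_sep [] //;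
  try exact: leN; rewrite ?l1 ?l2 //.
all: by move=> k; exists k; tauto.
Qed.

(** * Permutations with a prescribed cycle type *)

Lemma order_fconnect f x y : fconnect f x y -> order f x = order f y.
Proof.
move=> cxy; apply: eq_card => z.
exact: same_connect (perm_connect_sym f) _ _ cxy z.
Qed.

(** A cycle of length [l] has [l] points, all of order [l]. A constant [F] yields the size of [A],
    an indicator the number of points on [l]-cycles. *)
Lemma sum_order f A (F : nat -> nat) : perm_on A f ->
  \sum_(x in A) F (order f x) = \sum_(l <- cycle_type f A) l * F l.
Proof.
move=> Af; rewrite /cycle_type big_map big_enum /=.
rewrite (partition_big (froot f) (mem (cycle_roots f A))) /=; last first.
  by move=> x Ax; apply: froot_cycle_roots.
apply: eq_bigr => r; rewrite inE => /andP[Ar /eqP rr].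
rewrite -[RHS]/(#|fconnect f r| * _) -sum_nat_const.
apply: eq_big => [x|x /andP[_ /eqP <-]].
  rewrite -[RHS]/(fconnect f r x) -(root_connect (perm_connect_sym f)) rr.
  rewrite eq_sym andb_idl // => /eqP rx.
  rewrite -(perm_on_fconnect (x := r) Af) //.
  by rewrite -(root_connect (perm_connect_sym f)) -rx rr.
by rewrite (order_fconnect (connect_root _ x)).
Qed.

Lemma sumn_cycle_type f A : perm_on A f -> sumn (cycle_type f A) = #|A|.
Proof.
move=> Af; rewrite sumnE -sum1_card (sum_order (fun _ => 1) Af).
by apply: eq_bigr => l _; rewrite muln1.
Qed.

Lemma card_order_eq f A l : perm_on A f ->
  #|[set x in A | order f x == l]| = l * count_mem l (cycle_type f A).
Proof.
move=> Af; rewrite -sum1dep_card big_mkcondr /=.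
rewrite (eq_bigr (fun x => nat_of_bool (order f x == l))); last first.
  by move=> x _; case: eqP.
rewrite (sum_order (fun k => nat_of_bool (k == l)) Af).
rewrite -sum1_count big_distrr /= [RHS]big_mkcond /=.
by apply: eq_bigr => k _; case: eqP => [->|_]; rewrite !(muln1, muln0).
Qed.

Lemma restr_permE_closed f (B : {set T}) :
  {in B, forall y, f y \in B} -> {in B, restr_perm B f =1 f}.
Proof.
move=> fB y By; apply: restr_permE => //; apply/astabsP => z /=.
have fBE : f @: B = B.
  apply/eqP; rewrite eqEcard card_imset ?leqnn ?andbT; last exact: perm_inj.
  by apply/subsetP => _ /imsetP[u Bu ->]; apply: fB.
by rewrite /aperm -{1}fBE mem_imset //; apply: perm_inj.
Qed.

Lemma fconnect_restr_perm f (B : {set T}) : {in B, forall y, f y \in B} ->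
  {in B, forall x, fconnect (restr_perm B f) x =1 fconnect f x}.
Proof.
move=> fB x Bx.
have itB k : iter k f x \in B by elim: k => //= k; apply: fB.
have itE k : iter k (restr_perm B f) x = iter k f x.
  by elim: k => //= k ->; rewrite restr_permE_closed.
move=> y; apply/idP/idP => cxy;
  rewrite -(iter_findex cxy) ?itE ?fconnect_iter //.
by rewrite -itE fconnect_iter.
Qed.

(** The complement in [A] of the cycle of [x] is a union of cycles, on which the restriction has the
    same orbits as [f]. *)
Lemma cycle_type_remove f A (B : {set T}) x : perm_on A f -> x \in A ->
    B = A :\: [set y | fconnect f x y] ->
  perm_eq (cycle_type f A) (order f x :: cycle_type (restr_perm B f) B).
Proof.
move=> Af Ax BE; set g := restr_perm B f.
have fB : {in B, forall y, f y \in B}.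
  move=> y; rewrite BE !inE (perm_closed _ Af) => /andP[nxy ->]; rewrite andbT.
  by rewrite -same_fconnect1_r //; apply: perm_inj.
have conE : {in B, forall y, fconnect g y =1 fconnect f y}.
  exact: fconnect_restr_perm.
(* A root is picked from the orbit as a set, so equal orbits have the same root. *)
have rootE : {in B, froot g =1 froot f}.
  by move=> y By; rewrite /fingraph.root (eq_pick (conE y By)).
have ordE : {in B, order g =1 order f}.
  by move=> y By; apply: eq_card => z; apply: conE.
have Rx := froot_cycle_roots Af Ax.
rewrite (order_fconnect (connect_root _ x)).
have -> : cycle_type g B = [seq order f r | r <- enum (cycle_roots g B)].
  by apply/eq_in_map => r; rewrite mem_enum inE => /andP[/ordE].
rewrite -map_cons; apply: perm_map; apply: uniq_perm; rewrite ?enum_uniq //=.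
  rewrite mem_enum BE !inE; apply/andP; split; last exact: enum_uniq.
  by rewrite connect_root.
move=> r; rewrite inE !mem_enum.
have [->|rx] /= := eqVneq r (froot f x); first by rewrite Rx.
rewrite [LHS]inE [RHS]inE.
have [Br|Br] := boolP (r \in B).
  by rewrite /fingraph.roots rootE //; move: Br; rewrite BE inE => /andP[_ ->].
apply/andP => -[Ar /eqP rr]; move: Br; rewrite BE !inE Ar andbT negbK.
by rewrite -(root_connect (perm_connect_sym f)) rr eq_sym (negbTE rx).
Qed.

(* Mark a point of an [l]-cycle, in one of [l * count_mem l] ways. A marked
   permutation is recovered from the word of its marked cycle, for which there
   are [#|A| ^_ l] choices, and its restriction to the rest of [A]. *)
Lemma card_cycle_type_le (l : seq nat) A : all (ltn 0) l ->
  #|[set f : {perm T} | perm_on A f && perm_eq (cycle_type f A) l]| * w l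
    <= #|A|`!.
Proof.
elim: l A => [|l s IH] A /=.
  rewrite /w big_nil muln1 -card_perm => _; apply/subset_leq_card/subsetP => f.
  by rewrite inE => /andP[].
case/andP=> l_gt0 s_gt0; rewrite w_cons.
set X := [set f | _]; pose Y := [set p : {perm T} * T |
  [&& p.1 \in X, p.2 \in A & order p.1 p.2 == l]].
have cardY : #|Y| = #|X| * ((count_mem l s).+1 * l).
  rewrite -sum1_card (eq_bigl (fun p : {perm T} * T => (p.1 \in X) &&
    ((p.2 \in A) && (order p.1 p.2 == l)))); last by move=> p; rewrite inE.
  rewrite -(pair_big_dep (mem X)
    (fun f x => (x \in A) && (order f x == l)) (fun _ _ => 1)) /=.
  rewrite -sum_nat_const; apply: eq_bigr => f.
  rewrite inE => /andP[Af /seq.permP ct].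
  rewrite sum1dep_card card_order_eq // ct /= eqxx mulnC.
  by rewrite (_ : count _ s = count_mem l s).
rewrite mulnA -cardY.
have [lA|lA] := leqP l #|A|; last first.
  suff -> : Y = set0 by rewrite cards0.
  apply/setP => -[f x]; rewrite !inE /=.
  apply/negP => /andP[/andP[Af ct] /andP[Ax /eqP ol]].
  have := sumn_cycle_type Af; rewrite sumnE (perm_big _ ct) big_cons /=; lia.
pose word (p : {perm T} * T) : l.-tuple T := [tuple iter i p.1 p.2 | i < l].
have wordE (f : {perm T}) x : order f x = l ->
    word (f, x) = fingraph.orbit f x :> seq T.
  move=> ol; rewrite /fingraph.orbit ol; apply: (@eq_from_nth _ x).
    by rewrite size_tuple size_traject.
  move=> i; rewrite size_tuple => il; rewrite nth_traject //.
  by rewrite -[i]/(val (Ordinal il)) -tnth_nth tnth_mktuple.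
set W := [set t : l.-tuple T | all (mem A) t & uniq t].
have := card_uniq_tuples l (mem A); rewrite -/W => cardW.
(* The falling factorial counts the words; the remaining factorial bounds each fiber of [word], by
   induction on the rest of [A]. *)
rewrite -(ffact_fact lA) -[#|A|]/(#|mem A|) -cardW.
rewrite -sum1_card (partition_big word (mem W)) /=; last first.
  case=> f x; rewrite !inE /= => /andP[/andP[Af _] /andP[Ax /eqP ol]].
  rewrite wordE // orbit_uniq andbT; apply/allP => y.
  by rewrite -fconnect_orbit => /(perm_on_fconnect Af) cxy; rewrite inE -cxy.
rewrite big_distrl /= -sum_nat_const; apply: leq_sum => c Wc.
rewrite sum1dep_card.
set B := A :\: [set y in val c].
have cardB : #|B| = #|A| - l.
  move: Wc; rewrite inE => /andP[/allP cA cU].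
  rewrite cardsD; congr (_ - _); rewrite (setIidPr _); last first.
    by apply/subsetP => y; rewrite inE => /cA.
  by rewrite cardsE (card_uniqP cU) size_tuple.
rewrite -cardB; apply: leq_trans (IH B s_gt0).
rewrite leq_mul2r; apply/orP; right.
set Yc := [set _ | _].
have YcP f x : (f, x) \in Yc ->
    [/\ perm_on A f, perm_eq (cycle_type f A) (l :: s), x \in A, order f x = l &
        [set y in val c] = [set y | fconnect f x y]].
  rewrite !inE /= => /andP[/andP[/andP[Af ct] /andP[Ax /eqP ol]] /eqP wc].
  split=> //; apply/setP => y; rewrite !inE fconnect_orbit.
  by rewrite -wordE // wc.
have BP f x : (f, x) \in Yc -> {in B, forall y, f y \in B}.
  case/YcP => Af _ _ _ cE y.
  rewrite /B cE !inE (perm_closed _ Af) => /andP[nxy ->].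
  by rewrite andbT -same_fconnect1_r //; apply: perm_inj.
rewrite -(@card_in_imset _ _ (fun p : {perm T} * T => restr_perm B p.1)).
  apply/subset_leq_card/subsetP => _ /imsetP[[f x] fx ->] /=; rewrite inE.
  rewrite restr_perm_on /=; have [Af ct Ax ol cE] := YcP f x fx.
  have := cycle_type_remove Af Ax; rewrite -cE ol => /(_ B erefl) ct'.
  by rewrite -(perm_cons l); rewrite perm_sym in ct'; apply: perm_trans ct' ct.
case=> f1 x1 [f2 x2] Y1 Y2 /= e.
have wE : word (f1, x1) = word (f2, x2).
  by move: Y1 Y2; rewrite !inE => /andP[_ /eqP->] /andP[_ /eqP->].
have itE i : i < l -> iter i f1 x1 = iter i f2 x2.
  move=> il; have /(congr1 (fun t : l.-tuple T => tnth t (Ordinal il))) := wE.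
  by rewrite !tnth_mktuple.
have x12 : x1 = x2 by apply: (itE 0).
have [Af1 _ Ax1 ol1 cE1] := YcP _ _ Y1; have [Af2 _ Ax2 ol2 cE2] := YcP _ _ Y2.
congr (_, _) => //; apply/permP => y.
have [By|nBy] := boolP (y \in B).
  by rewrite -(restr_permE_closed (BP _ _ Y1) By) e
             (restr_permE_closed (BP _ _ Y2) By).
have [Ay|nAy] := boolP (y \in A); last first.
  by rewrite (out_perm Af1) ?(out_perm Af2).
have : fconnect f1 x1 y by move: nBy; rewrite /B cE1 !inE Ay andbT negbK.
move=> cy; have [i il <-] : exists2 i, i < l & iter i f1 x1 = y.
  by exists (findex f1 x1 y); rewrite ?iter_findex // -ol1 findex_max.
rewrite -[LHS]/(iter i.+1 f1 x1).
have -> : f2 (iter i f1 x1) = iter i.+1 f2 x2 by rewrite itE.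
(* The image of the last letter is not in the word at the next place: there the cycle closes up at
   the marked point. *)
move: il; rewrite leq_eqVlt => /orP[/eqP il|]; last exact: itE.
by rewrite il -{1}ol1 -ol2 !iter_order //; apply: perm_inj.
Qed.

End CycleType.

(** * Commutative 3-nilpotent tables invariant under a permutation *)

Section Tables.

Variable T : finType.
Implicit Types (m : table T) (f s : {perm T}) (A : {set T}).

Lemma nilpotent_zeroP m : is_3nilpotent m ->
  exists o, [/\ forall x, m (o, x) = o, forall x, m (x, o) = o,
    forall x y z, m (m (x, y), z) = o & exists a b, m (a, b) != o].
Proof.
case/existsP=> o /and3P[/forallP zo /forallP no /existsP[a /existsP[b ab]]].
exists o; split; try by move=> x; case/andP: (zo x) => /eqP ? /eqP.
  by move=> x y z; apply/eqP; apply: (forallP (forallP (no x) y)).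
by exists a, b.
Qed.

Lemma mem_square m x y : m (x, y) \in square m.
Proof. by apply: imset_f; rewrite inE. Qed.

Lemma squareP m x : reflect (exists a b, x = m (a, b)) (x \in square m).
Proof.
apply: (iffP imsetP) => [[[a b] _ ->]|[a [b ->]]]; first by exists a, b.
by exists (a, b); rewrite ?inE.
Qed.

(** If every element were a product, the left factor of a nonzero product would be one too, giving a
    nonzero triple product. *)
Lemma card_nonsquare_gt0 m : is_3nilpotent m -> 0 < #|~: square m|.
Proof.
case/nilpotent_zeroP=> o [_ _ nil [a [b ab]]]; rewrite card_gt0.
apply: contraNneq ab => sq0; have /squareP[x [y ->]] : a \in square m.
  by move/setP/(_ a): sq0; rewrite !inE => /negbFE.
by rewrite nil.
Qed.

Lemma card_square_gt1 m : is_3nilpotent m -> 1 < #|square m|.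
Proof.
case/nilpotent_zeroP=> o [zl _ _ [a [b ab]]]; apply/card_gt1P.
by exists (m (a, b)), o; split; rewrite ?mem_square // -(zl o) mem_square.
Qed.

(** A factor outside [A] is a product, so it multiplies everything to zero. On [A] the table is
    constant on orbits of pairs, because [f] fixes all products. Codes of pairs, with one extra
    index for the zero, thus map onto the complement of [A]. *)
Lemma card_invariant_tables f A : perm_on A f ->
  #|[set m : table T | [&& is_commutative m, is_3nilpotent m,
       square m == ~: A & is_automorphism m f]]|
  <= stirling2 (gamma (cycle_type f A)).+1 #|~: A| * #|~: A|`!.
Proof.
move=> Af; set M := [set m | _].
have [->|[m0 m0M]] := set_0Vmem M; first by rewrite cards0.
have [o0 _] : exists o0 : T, True.
  by move: m0M; rewrite inE => /and4P[_ /existsP[o0 _] _ _]; exists o0.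
have [c [c_lt c_sep]] := exists_pair_code Af.
set N := (gamma _).+1.
pose isz m o := is_zero m o &&
  [forall x, forall y, forall z, m (m (x, y), z) == o].
pose zero m := odflt o0 [pick o | isz m o].
(* The last index exceeds every code, so it always carries the zero, as do indices that code no
   pair. *)
pose G m : {ffun 'I_N -> T} := [ffun i : 'I_N =>
  if [pick p : T * T | [&& p.1 \in A, p.2 \in A & c p.1 p.2 == i]] is Some p
  then m p else zero m].
have MP m : m \in M -> [/\ forall x y, m (x, y) = m (y, x),
     forall x y, x \notin A -> m (x, y) = zero m, zero m \notin A,
     forall x, (x \notin A) = (x \in square m)
   & forall x y, f (m (x, y)) = m (f x, f y)].
  rewrite inE => /and4P[/forallP cm nm /eqP sq /forallP am].
  have cmE x y : m (x, y) = m (y, x) by apply/eqP; apply: (forallP (cm x)).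
  have sqE x : (x \notin A) = (x \in square m) by rewrite sq inE.
  have : isz m (zero m).
    rewrite /zero; case: pickP => //= nz.
    by case/existsP: nm => o /and3P[z1 z2 _]; have := nz o; rewrite /isz z1 z2.
  case/andP=> /forallP z1 /forallP z2.
  split=> // [x y||x y].
  - rewrite sqE => /squareP[a [b ->]].
    by apply/eqP; apply: (forallP (forallP (z2 a) b)).
  - by rewrite sqE -(eqP (andP (z1 (zero m))).1) mem_square.
  - by apply/eqP; apply: (forallP (am x)).
(* Invariance gives [f (m (u, v))] for the product of the images, and [f] is the identity off [A],
   where products lie. *)
have orbE m x y x' y' : m \in M ->
    same_pair_orbit f x y x' y' -> m (x', y') = m (x, y).
  move=> /MP[cm _ _ sq am] [k].
  have itE u v : m (iter k f u, iter k f v) = m (u, v).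
    by elim: k => //= k IH; rewrite -am IH (out_perm Af) // sq mem_square.
  by case=> -[<- <-]; rewrite itE // cm.
have GE m x y : m \in M -> x \in A -> y \in A -> G m (inord (c x y)) = m (x, y).
  move=> mM Ax Ay; have cN : c x y < N by apply: ltnW; apply: c_lt.
  rewrite ffunE (inordK cN).
  case: pickP => [[u v] /= /and3P[Au Av /eqP cuv]|/(_ (x, y))]; last first.
    by rewrite /= Ax Ay eqxx.
  by apply: orbE => //; apply: c_sep.
have G0 m : G m ord_max = zero m.
  rewrite ffunE; case: pickP => //= -[u v] /= /and3P[Au Av /eqP cuv].
  by have := c_lt u v Au Av; rewrite cuv ltnn.
rewrite -(@card_in_imset _ _ G); last first.
  move=> m1 m2 M1 M2 G12; apply/ffunP => -[x y].
  have z12 : zero m1 = zero m2 by rewrite -!G0 G12.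
  have [cm1 o1 _ _ _] := MP _ M1; have [cm2 o2 _ _ _] := MP _ M2.
  have [Ax|/[dup]/o1-> /o2->] := boolP (x \in A); last exact: z12.
  have [Ay|ny] := boolP (y \in A); first by rewrite -!GE // G12.
  by rewrite cm1 cm2 o1 // o2.
apply: leq_trans (card_ffun_im_eq N (~: A)); apply/subset_leq_card.
apply/subsetP => _ /imsetP[m mM ->]; rewrite inE; apply/eqP/setP => x.
have [cm om zA sq _] := MP _ mM; rewrite inE sq.
apply/imsetP/idP => [[i _ ->]|/squareP[a [b ->]]].
  rewrite ffunE; case: pickP => [[u v] _|_]; first exact: mem_square.
  by rewrite -sq.
have [Aa|na] := boolP (a \in A); last by exists ord_max; rewrite ?inE // G0 om.
have [Ab|nb] := boolP (b \in A); last first.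
  by exists ord_max; rewrite ?inE // G0 cm om.
by exists (inord (c a b)); rewrite ?inE // GE.
Qed.

(** * Relabelling of tables and orbit counting *)

(** Transport of structure: [s] becomes an isomorphism from [m] to the result. Isomorphism classes
    are then orbits, and automorphisms are stabilizers. *)
Definition relabel m s : table T :=
  [ffun p => s (m ((s^-1)%g p.1, (s^-1)%g p.2))].

Lemma relabel1 : relabel^~ 1%g =1 id.
Proof. by move=> m; apply/ffunP=> -[x y]; rewrite ffunE invg1 !perm1. Qed.

Lemma relabelM m : act_morph relabel m.
Proof. by move=> s t; apply/ffunP=> -[x y]; rewrite !ffunE invMg !permM. Qed.

Definition relabel_action := TotalAction relabel1 relabelM.

Lemma is_isomorphismE m1 m2 s : is_isomorphism m1 m2 s = (relabel m1 s == m2).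
Proof.
apply/forallP/eqP => [iso|<- x].
  apply/ffunP => -[x y]; rewrite ffunE /=.
  by rewrite (eqP (forallP (iso _) _)) !permKV.
by apply/forallP => y; rewrite ffunE /= !permK.
Qed.

Lemma semirigid_relabel m s :
  m \in semirigid_comm_3nilpotent T ->
  relabel m s \in semirigid_comm_3nilpotent T.
Proof.
rewrite !inE => /and4P[/forallP sm /forallP cm nm /forallP rm].
have rE x y : relabel m s (s x, s y) = s (m (x, y)) by rewrite ffunE /= !permK.
have sE x : exists x', x = s x' by exists ((s^-1)%g x); rewrite permKV.
apply/and4P; split.
- apply/forallP=> x; apply/forallP=> y; apply/forallP=> z.
  have [[[x' ->] [y' ->]] [z' ->]] := (sE x, sE y, sE z); rewrite !rE.
  by rewrite (inj_eq perm_inj); apply: (forallP (forallP (sm x') y')).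
- apply/forallP=> x; apply/forallP=> y.
  have [[x' ->] [y' ->]] := (sE x, sE y); rewrite !rE.
  by rewrite (inj_eq perm_inj); apply: (forallP (cm x')).
- have [o [zl zr nil [a [b ab]]]] := nilpotent_zeroP nm.
  apply/existsP; exists (s o); apply/and3P; split.
  + apply/forallP=> x; have [x' ->] := sE x.
    by rewrite !rE zl zr eqxx.
  + apply/forallP=> x; apply/forallP=> y; apply/forallP=> z.
    have [[[x' ->] [y' ->]] [z' ->]] := (sE x, sE y, sE z).
    by rewrite !rE nil.
  + apply/existsP; exists (s a); apply/existsP; exists (s b).
    by rewrite rE (inj_eq perm_inj).
apply/forallP=> f; apply/implyP.
rewrite /is_automorphism is_isomorphismE => /eqP fm.
apply/forallP=> x; apply/implyP=> /squareP[a [b ->]].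
have [[a' ->] [b' ->]] := (sE a, sE b); rewrite rE.
(* An automorphism [f] of the relabelled table is conjugated back to one of [m]; products compose
   from left to right. *)
have := rm (s * f * s^-1)%g; rewrite /is_automorphism is_isomorphismE.
have -> : relabel m (s * f * s^-1)%g = m.
  by rewrite !relabelM fm -relabelM mulgV relabel1.
rewrite eqxx /= => /forallP/(_ (m (a', b'))); rewrite mem_square /=.
by rewrite !permM => /eqP {2}<-; rewrite permKV.
Qed.

Lemma semirigid_classes_Burnside :
  #|equivalence_partition (@isomorphic T) (semirigid_comm_3nilpotent T)|
    * #|T|`! =
  \sum_(s : {perm T})
    #|[set m in semirigid_comm_3nilpotent T | is_automorphism m s]|.
Proof.
set S := semirigid_comm_3nilpotent T.
have acts : [acts [set: {perm T}], on S | relabel_action].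
  apply/subsetP => s _; rewrite !inE /=; apply/subsetP => m mS.
  by rewrite inE /=; apply: semirigid_relabel.
have := Frobenius_Cauchy acts; have -> : #|[set: {perm T}]| = #|T|`!.
  rewrite -[#|T|]cardsT -card_perm; apply: eq_card => s; rewrite inE.
  by apply/esym/subsetP => x _; rewrite inE.
move=> FC.
have -> : equivalence_partition (@isomorphic T) S =
    [set orbit relabel_action [set: {perm T}] m | m in S].
  apply: eq_in_imset => m mS; apply/setP => m'; rewrite inE.
  apply/andP/orbitP => [[_ /existsP[s]]|[s _ <-]].
    by rewrite is_isomorphismE => /eqP<-; exists s; rewrite ?inE.
  split; first exact: semirigid_relabel.
  by apply/existsP; exists s; rewrite is_isomorphismE.
rewrite -FC; apply: eq_big => [s|s _]; first by rewrite inE.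
by apply: eq_card => m; rewrite !inE sub1set inE /is_automorphism is_isomorphismE.
Qed.

(** Tables are sorted by the complement [A] of their square. Semirigidity confines [s] to [A]; the
    square contains zero and a nonzero product, which leaves at most [#|T| - 2] elements for [A]. *)
Lemma card_semirigid_fixed_le s :
  #|[set m in semirigid_comm_3nilpotent T | is_automorphism m s]| <=
  \sum_(A : {set T} | (0 < #|A| <= #|T| - 2) && perm_on A s)
    stirling2 (gamma (cycle_type s A)).+1 (#|T| - #|A|) * (#|T| - #|A|)`!.
Proof.
rewrite -sum1_card (partition_big (fun m => ~: square m)
  (fun A : {set T} => (0 < #|A| <= #|T| - 2) && perm_on A s)) /=; last first.
  move=> m; rewrite !inE => /andP[/and4P[_ _ nm rm] am].
  rewrite card_nonsquare_gt0 //=; apply/andP; split.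
    rewrite -(cardsC (square m)); have := card_square_gt1 nm.
    by move: #|square m| #|~: _| => a b; lia.
  apply/subsetP => x; rewrite !inE; apply: contra => xs.
  by have := implyP (forallP rm s) am => /forallP/(_ x)/implyP/(_ xs).
apply: leq_sum => A /andP[_ As].
have -> : #|T| - #|A| = #|~: A| by rewrite -(cardsC A) addKn.
apply: leq_trans (card_invariant_tables As); rewrite sum1dep_card.
apply/subset_leq_card/subsetP => m.
rewrite !inE => /andP[/andP[/and4P[_ -> -> _] ->] /eqP <-].
by rewrite setCK eqxx.
Qed.

End Tables.

(** * Summation over cycle types and over subsets *)

Lemma sort_cycle_type_intparts (T : finType) (f : {perm T}) (A : {set T}) :
  perm_on A f -> sort geq (cycle_type f A) \in intparts #|A|.
Proof.
move=> Af; rewrite mem_intparts; apply/and3P; split.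
- by apply: sort_sorted => a b; apply: leq_total.
- rewrite all_sort; apply/allP => _ /mapP[r _ ->]; exact: fingraph.order_gt0.
- by rewrite -(sumn_cycle_type Af) !sumnE (perm_big _ (permEl (perm_sort _ _))).
Qed.

Local Open Scope ring_scope.

Lemma sum_perm_on_cycle_type_le (T : finType) (A : {set T}) (F : nat -> nat) :
  (\sum_(f : {perm T} | perm_on A f) F (gamma (cycle_type f A)))%N%:R <=
    (#|A|`!)%:R * \sum_(l <- intparts #|A|) (F (gamma l))%:R / (w l)%:R :> rat.
Proof.
pose N l := #|[set f : {perm T} | perm_on A f && perm_eq (cycle_type f A) l]|.
have le1 : (\sum_(f : {perm T} | perm_on A f) F (gamma (cycle_type f A)) <=
    \sum_(l <- intparts #|A|) N l * F (gamma l))%N.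
  rewrite (eq_bigr (fun l => \sum_(f : {perm T} |
      perm_on A f && perm_eq (cycle_type f A) l) F (gamma l))%N); last first.
    by move=> l _; rewrite -sum_nat_cond_const.
  rewrite (exchange_big_dep (fun f : {perm T} => perm_on A f)) /=; last first.
    by move=> l f _ /andP[].
  apply: leq_sum => f Af.
  have pl : perm_eq (cycle_type f A) (sort geq (cycle_type f A)).
    by rewrite perm_sym perm_sort.
  (* The term of the sorted cycle type alone already covers the contribution of [f]. *)
  rewrite (big_rem _ (sort_cycle_type_intparts Af)) /= Af pl /=.
  by rewrite (perm_gamma pl) leq_addr.
apply: le_trans (_ : _ <= (\sum_(l <- intparts #|A|) N l * F (gamma l))%N%:R) _.
  by rewrite ler_nat.
rewrite natr_sum mulr_sumr big_seq [leRHS]big_seq; apply: ler_sum => l.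
rewrite mem_intparts => /and3P[_ l_gt0 _].
have w0 : 0 < (w l)%:R :> rat by rewrite ltr0n w_gt0.
rewrite natrM mulrCA mulrC ler_wpM2l ?ler0n // ler_pdivlMr // -natrM ler_nat.
exact: card_cycle_type_le.
Qed.

Lemma sum_sets_by_card (T : finType) (a b : nat) (H : nat -> rat) :
  \sum_(A : {set T} | (a <= #|A| < b)%N) H #|A| =
    \sum_(a <= r < b) 'C(#|T|, r)%:R * H r.
Proof.
rewrite [RHS](eq_bigr (fun r => \sum_(A : {set T} | r == #|A|) H r));
  last first.
  move=> r _; rewrite (eq_bigl (mem [set A : {set T} | #|A| == r])); last first.
    by move=> A; rewrite !inE eq_sym.
  by rewrite sumr_const card_draws mulr_natl.
rewrite (exchange_big_dep xpredT) //= big_mkcond; apply: eq_bigr => A _.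
by rewrite big_nat1_eq.
Qed.

Theorem theorem7p2 (n : nat) (hn : (3 <= n)%N) :
  (num_semirigid_comm_3nilpotent n)%:R <=
    \sum_(1 <= r < (n - 2).+1) \sum_(l <- intparts r)
      (stirling2 (gamma l + 1)%N (n - r)%N)%:R / (w l)%:R :> rat.
Proof.
have fact0 : 0 < (n`!)%:R :> rat by rewrite ltr0n fact_gt0.
rewrite -(ler_pM2r fact0) -natrM /num_semirigid_comm_3nilpotent.
have := semirigid_classes_Burnside 'I_n.
rewrite [X in (_ * X`!)%N]card_ord => ->.
pose G r : rat := \sum_(l <- intparts r)
  (stirling2 (gamma l + 1)%N (n - r)%N)%:R / (w l)%:R.
(* The factor [n!] splits as a binomial coefficient times [r! (n - r)!], and the binomial is spent
   on the sets of size [r]. *)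
have -> : (\sum_(1 <= r < (n - 2).+1) G r) * (n`!)%:R =
    \sum_(A : {set 'I_n} | (0 < #|A| < (n - 2).+1)%N)
      ((n - #|A|)`! * #|A|`!)%:R * G #|A|.
  rewrite (sum_sets_by_card _ _ _ (fun r => ((n - r)`! * r`!)%:R * G r)).
  rewrite mulr_suml; apply: eq_big_nat => r /andP[_ rn].
  rewrite mulrA -natrM card_ord mulrC [((n - r)`! * _)%N]mulnC bin_fact //; lia.
apply: le_trans (_ : _ <= (\sum_(A : {set 'I_n} | (0 < #|A| < (n - 2).+1)%N)
    \sum_(s : {perm 'I_n} | perm_on A s)
      stirling2 (gamma (cycle_type s A)).+1 (n - #|A|) * (n - #|A|)`!)%N%:R) _.
  (* Fixing [A] before [s] allows the permutations of [A] to be grouped by type. *)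
  rewrite ler_nat (exchange_big_dep xpredT) //=; apply: leq_sum => s _.
  apply: leq_trans (card_semirigid_fixed_le s) _.
  by rewrite card_ord; apply: eq_leq; apply: eq_bigl => A.
rewrite natr_sum; apply: ler_sum => A _.
rewrite -big_distrl /= mulnC 2!natrM -mulrA ler_wpM2l ?ler0n //.
apply: le_trans (sum_perm_on_cycle_type_le A
  (fun g => stirling2 g.+1 (n - #|A|))) _.
by rewrite /G; under [X in _ <= _ * X]eq_bigr do rewrite addn1.
Qed.
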